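(* Let $\mathbb{F}$ be a field of characteristic not $2$. Let $A\in\mathrm{GL}_n(\mathbb{F})$, and let $k\geq n$ be an integer such that $(-1)^k\det A=1$. Then the matrix $A\oplus(-I_k)\in\mathrm{GL}_{n+k}(\mathbb{F})$ is the product of three $U_2$-matrices.
   Context: $A\oplus B$ denotes the block-diagonal matrix with diagonal blocks $A$ and $B$. A $U_2$-matrix (unipotent of index $2$) is a matrix $U\in\mathrm{GL}_m(\mathbb{F})$ such that $(U-I_m)^2=0$ (so $I_m$ is a $U_2$-matrix). *)

(* Defs.v *)
From mathcomp Require Import all_boot all_order all_algebra.
Set Implicit Arguments.
Unset Strict Implicit.
Unset Printing Implicit Defensive.

Import GRing.Theory.
Local Open Scope ring_scope.

(* The library's {'GL_m[F]} needs a finite field and turns m = 0 into m = 1,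
   so membership in GL_m is expressed with unitmx. *)
Definition U2_matrix (F : fieldType) (m : nat) (U : 'M[F]_m) : Prop :=
  U \in unitmx /\ (U - 1%:M) *m (U - 1%:M) = 0.

Definition dsum_mx (F : fieldType) (n k : nat) (A : 'M[F]_n) (B : 'M[F]_k) :
  'M[F]_(n + k) := block_mx A 0 0 B.

(* Main.v *)
Require Import Defs.
From mathcomp Require Import all_boot all_order all_algebra.
From mathcomp Require Import ring.
Import GRing.Theory.
Local Open Scope ring_scope.

(** Put M for the direct sum of A and - I_k, of size N = n + k. Products of three
    [U2]-matrices are stable under conjugation and direct sums, so M may be
    replaced by a normal form. Since r = rank (A + 1) <= n <= k, the
    perturbation M + 1 has rank r <= N / 2, and this leaves enough room to show
    that M is similar to the direct sum of - I_e and - [[B, 1], [0, 1]] for some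
    invertible B of size r ([dsum_opp1_normal_form]); the hypothesis on the
    determinant becomes (-1) ^ e det B = 1. As - I_2 is itself a product of
    three [U2]-matrices, only e = 0 and e = 1 remain.

    The key step is [three_U2_of_factorization]. Multiplying - [[B, 1], [0, 1]]
    by a [U2]-matrix [[1, 0], [Y, 1]] produces, up to similarity, the companion
    matrix of t^2 - D t + B with D as arbitrary as Y. Every factorization
    B = Q P is reached, through D = P + Q up to sign, which makes the companion
    matrix similar to [[P, -1], [0, Q]]. Hence it is enough to factor B so that
    [[P, -1], [0, Q]] is a product of two [U2]-matrices. When e = 1, the
    additional diagonal entry -1 may also be coupled to P by an arbitrary row.

    Two kinds of products of two [U2]-matrices are used: every unipotent matrix
    ([two_U2_unipotent]), and [[R^-1, 1], [0, R]] for every invertible R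
    ([two_U2_inverse_pair]).

    If B is not scalar, it is similar to a product of a lower and an upper
    triangular matrix with prescribed diagonals of product det B (Sourour's
    argument, [nonscalar_schur]). For e = 0 both are taken unipotent. For e = 1
    one diagonal entry of P is -1; together with the additional -1 it forms a
    Jordan block of size 2, which splits off, as -1 <> 1, and leaves a unipotent
    matrix.

    If B = b is scalar then Q = b P^-1 is forced. For e = 0, b ^ r = 1 and
    b <> 1, -1, take for P a weighted cyclic shift with P ^ r = b: then P is
    similar to b P, so that Q is similar to P^-1, while P and Q are annihilated
    by the coprime polynomials t ^ r - b and t ^ r - b^-1. For e = 1, b ^ r = -1;
    let m be the least exponent with b ^ m = -1. Since b ^ (r - m) = 1, the
    previous case reduces the problem to r = m, where diagonal P and Q whose
    entries are powers of b work: their eigenvalues are pairs x, x^-1, one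
    eigenvalue 1, and one eigenvalue -1 that is absorbed as above. *)

Set Implicit Arguments.
Unset Strict Implicit.
Unset Printing Implicit Defensive.

Section ThreeU2.
Variable F : fieldType.

(** * Auxiliary facts on matrices *)

Lemma scalar_mxX n (c : F) m : (c%:M : 'M[F]_n) ^+ m = (c ^+ m)%:M.
Proof. by elim: m => [|m IH]; rewrite ?expr0 // !exprS IH scalar_mxM. Qed.

Lemma scalar_mx_unit n (c : F) : c != 0 -> (c%:M : 'M[F]_n) \in unitmx.
Proof. by move=> c0; rewrite unitmxE det_scalar unitrX // unitfE. Qed.

Lemma col_mulmx m n p (A : 'M[F]_(m, n)) (B : 'M[F]_(n, p)) j : col j (A *m B) = A *m col j B.
Proof. by rewrite !colE mulmxA. Qed.

(** * Products of two and three U2-matrices up to similarity *)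

Definition two_U2 n (X : 'M[F]_n) := exists U V, [/\ U2_matrix U, U2_matrix V & X = U *m V].
Definition three_U2 n (M : 'M[F]_n) := exists X U, [/\ two_U2 X, U2_matrix U & M = X *m U].

(** The two sizes are kept independent, although similarity forces them to be
    equal: block decompositions can then be rearranged, and bases completed,
    without casting along equations between sizes. *)
Definition sim n p (A : 'M[F]_n) (B : 'M[F]_p) :=
  exists P : 'M[F]_(p, n), exists Q : 'M[F]_(n, p),
  [/\ P *m Q = 1%:M, Q *m P = 1%:M & P *m A = B *m P].

Lemma sqr0_U2 n (N : 'M[F]_n) : N *m N = 0 -> U2_matrix (1%:M + N).
Proof.
move=> N2; split; last by rewrite addrAC subrr add0r.
apply: (proj1 (mulmx1_unit (B := 1%:M - N) _)).
by rewrite mulmxDl !mulmxBr !mul1mx mulmx1 N2 subr0 subrK.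
Qed.

Lemma U2_1 n : U2_matrix (1%:M : 'M[F]_n).
Proof. by rewrite -[X in U2_matrix X]addr0; apply: sqr0_U2; rewrite mulmx0. Qed.

Lemma sim_refl n (A : 'M[F]_n) : sim A A.
Proof. by exists 1%:M, 1%:M; rewrite !mul1mx mulmx1. Qed.

Lemma sim_sym n p (A : 'M[F]_n) (B : 'M[F]_p) : sim A B -> sim B A.
Proof.
case=> P [Q [PQ QP e]]; exists Q, P; split=> //.
by rewrite -[LHS]mulmx1 -PQ -!mulmxA (mulmxA B) -e -(mulmxA P) (mulmxA Q) QP mul1mx.
Qed.

Lemma sim_trans n p q (A : 'M[F]_n) (B : 'M[F]_p) (C : 'M[F]_q) :
  sim A B -> sim B C -> sim A C.
Proof.
case=> P [Q [PQ QP e]] [P' [Q' [PQ' QP' e']]]; exists (P' *m P), (Q *m Q'); split.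
- by rewrite -mulmxA (mulmxA P) PQ mul1mx.
- by rewrite -mulmxA (mulmxA Q') QP' mul1mx.
- by rewrite -mulmxA e mulmxA e' mulmxA.
Qed.

Lemma sim_dim n p (A : 'M[F]_n) (B : 'M[F]_p) : sim A B -> n = p.
Proof.
case=> P [Q [PQ QP _]]; apply/eqP; rewrite eqn_leq; apply/andP; split.
  rewrite -{1}(mxrank1 F n) -QP; exact: leq_trans (mxrankM_maxl _ _) (rank_leq_col _).
rewrite -{1}(mxrank1 F p) -PQ; exact: leq_trans (mxrankM_maxl _ _) (rank_leq_col _).
Qed.

Lemma sim_det n p (A : 'M[F]_n) (B : 'M[F]_p) : sim A B -> \det A = \det B.
Proof.
move=> s; move: (sim_dim s) => enp; case: p / enp B s => B [P [Q [PQ QP e]]].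
have: \det (P *m A *m Q) = \det (B *m P *m Q) by rewrite e.
by rewrite -(mulmxA B) PQ mulmx1 !det_mulmx mulrC mulrA -det_mulmx QP det1 mul1r.
Qed.

Lemma sim_U2 n p (P : 'M[F]_(p, n)) (Q : 'M[F]_(n, p)) U :
  P *m Q = 1%:M -> Q *m P = 1%:M -> U2_matrix U -> U2_matrix (Q *m U *m P).
Proof.
move=> PQ QP [_ U2]; rewrite -[X in U2_matrix X](subrK 1%:M) addrC.
apply: sqr0_U2.
have -> : Q *m U *m P - 1%:M = Q *m (U - 1%:M) *m P by rewrite mulmxBr mulmxBl mulmx1 QP.
by rewrite !mulmxA -(mulmxA _ P) PQ mulmx1 -(mulmxA Q) U2 mulmx0 mul0mx.
Qed.

Lemma sim_prod n p (P : 'M[F]_(p, n)) (Q : 'M[F]_(n, p)) (A : 'M[F]_n) (U V : 'M[F]_p) :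
  P *m Q = 1%:M -> Q *m P = 1%:M -> P *m A = U *m V *m P ->
  A = (Q *m U *m P) *m (Q *m V *m P).
Proof.
move=> PQ QP e; rewrite -[LHS]mul1mx -QP -mulmxA e !mulmxA.
by rewrite -(mulmxA _ P Q) PQ mulmx1.
Qed.

Lemma sim_two n p (A : 'M[F]_n) (B : 'M[F]_p) : sim A B -> two_U2 B -> two_U2 A.
Proof.
case=> P [Q [PQ QP e]] [U [V [hU hV eB]]]; rewrite eB in e.
exists (Q *m U *m P), (Q *m V *m P); split; try exact: sim_U2.
exact: (sim_prod PQ QP e).
Qed.

Lemma sim_three n p (A : 'M[F]_n) (B : 'M[F]_p) : sim A B -> three_U2 B -> three_U2 A.
Proof.
case=> P [Q [PQ QP e]] [X [U [hX hU eB]]]; rewrite eB in e.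
exists (Q *m X *m P), (Q *m U *m P); split; last exact: (sim_prod PQ QP e).
  by apply: (sim_two _ hX); exists P, Q; split=> //; rewrite !mulmxA PQ mul1mx.
exact: sim_U2.
Qed.

Lemma mul_dsum n p (A A' : 'M[F]_n) (B B' : 'M[F]_p) :
  dsum_mx A B *m dsum_mx A' B' = dsum_mx (A *m A') (B *m B').
Proof. by rewrite /dsum_mx mulmx_block !(mulmx0, mul0mx) !(addr0, add0r). Qed.

Lemma dsum1 n p : dsum_mx 1%:M 1%:M = 1%:M :> 'M[F]_(n + p).
Proof. by rewrite /dsum_mx -scalar_mx_block. Qed.

Lemma dsum_U2 n p (U : 'M[F]_n) (V : 'M[F]_p) :
  U2_matrix U -> U2_matrix V -> U2_matrix (dsum_mx U V).
Proof.
move=> [_ hU] [_ hV]; rewrite -[X in U2_matrix X](subrK 1%:M) addrC.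
apply: sqr0_U2; rewrite -dsum1 /dsum_mx opp_block_mx add_block_mx !subr0.
by rewrite mulmx_block hU hV !(mulmx0, mul0mx) !addr0 block_mx0.
Qed.

Lemma dsum_two n p (X : 'M[F]_n) (Y : 'M[F]_p) : two_U2 X -> two_U2 Y -> two_U2 (dsum_mx X Y).
Proof.
move=> [U [V [hU hV ->]]] [U' [V' [hU' hV' ->]]].
by exists (dsum_mx U U'), (dsum_mx V V'); rewrite mul_dsum; split=> //; apply: dsum_U2.
Qed.

Lemma dsum_three n p (X : 'M[F]_n) (Y : 'M[F]_p) :
  three_U2 X -> three_U2 Y -> three_U2 (dsum_mx X Y).
Proof.
move=> [U [V [hU hV ->]]] [U' [V' [hU' hV' ->]]].
exists (dsum_mx U U'), (dsum_mx V V'); rewrite mul_dsum; split=> //.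
  exact: dsum_two.
exact: dsum_U2.
Qed.

Lemma two_U2_three n (X : 'M[F]_n) : two_U2 X -> three_U2 X.
Proof. by move=> h; exists X, 1%:M; rewrite mulmx1; split=> //; apply: U2_1. Qed.

Lemma two_U2_1 n : two_U2 (1%:M : 'M[F]_n).
Proof. by exists 1%:M, 1%:M; rewrite mulmx1; split=> //; apply: U2_1. Qed.

Lemma sim_dsum n p n' p' (A : 'M[F]_n) (A' : 'M[F]_n') (B : 'M[F]_p) (B' : 'M[F]_p') :
  sim A A' -> sim B B' -> sim (dsum_mx A B) (dsum_mx A' B').
Proof.
case=> P [Q [PQ QP e]] [P' [Q' [PQ' QP' e']]].
exists (block_mx P 0 0 P'), (block_mx Q 0 0 Q').
rewrite /dsum_mx !mulmx_block !(mulmx0, mul0mx) !(addr0, add0r) PQ QP PQ' QP' e e'.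
by rewrite -!scalar_mx_block.
Qed.

(** A similarity and not an equality, because the sizes of the two sides are only
    propositionally equal. *)
Lemma sim_blockA n p q (A : 'M[F]_n) (B : 'M[F]_(n, p)) (C : 'M[F]_(n, q)) (D : 'M[F]_(p, n))
    (G : 'M[F]_(q, n)) (E : 'M[F]_p) (H : 'M[F]_(p, q)) (K : 'M[F]_(q, p)) (L : 'M[F]_q) :
  sim (block_mx A (row_mx B C) (col_mx D G) (block_mx E H K L))
      (block_mx (block_mx A B D E) (col_mx C H) (row_mx G K) L).
Proof.
rewrite (@block_mxA _ n p q n p q).
move: (esym _) => e1; case: _ / e1 => /=.
rewrite castmx_id; exact: sim_refl.
Qed.

Lemma sim_dsumA n p q (A : 'M[F]_n) (B : 'M[F]_p) (C : 'M[F]_q) :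
  sim (dsum_mx A (dsum_mx B C)) (dsum_mx (dsum_mx A B) C).
Proof.
have := sim_blockA A 0 0 0 0 B 0 0 C.
by rewrite !row_mx0 !col_mx0.
Qed.

Lemma sim_dsum0 n (A : 'M[F]_0) (X : 'M[F]_n) : sim (dsum_mx A X) X.
Proof.
exists (row_mx 0 1%:M), (col_mx 0 1%:M); split.
- by rewrite mul_row_col mul0mx mulmx1 add0r.
- rewrite mul_col_row !(mulmx0, mul0mx, mulmx1) [RHS]scalar_mx_block; congr block_mx.
  by rewrite [RHS]flatmx0.
by rewrite mul_row_block mul_mx_row !(mulmx0, mul0mx, mulmx1, mul1mx, addr0, add0r).
Qed.

(** The interchange of the second and third of four groups of coordinates. *)
Lemma sim_shuffle m s (A B C D : 'M[F]_m) (A' B' C' D' : 'M[F]_s) :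
  sim (block_mx (dsum_mx A A') (dsum_mx B B') (dsum_mx C C') (dsum_mx D D'))
      (dsum_mx (block_mx A B C D) (block_mx A' B' C' D')).
Proof.
exists (block_mx (block_mx 1%:M 0 0 0) (block_mx 0 0 1%:M 0)
                 (block_mx 0 1%:M 0 0) (block_mx 0 0 0 1%:M)).
exists (block_mx (block_mx 1%:M 0 0 0) (block_mx 0 0 1%:M 0)
                 (block_mx 0 1%:M 0 0) (block_mx 0 0 0 1%:M)).
rewrite /dsum_mx; split.
- by rewrite !mulmx_block !(mulmx0, mul0mx, mulmx1, addr0, add0r, add_block_mx, block_mx0) -!scalar_mx_block.
- by rewrite !mulmx_block !(mulmx0, mul0mx, mulmx1, addr0, add0r, add_block_mx, block_mx0) -!scalar_mx_block.
- by rewrite !mulmx_block !(mulmx0, mul0mx, mulmx1, mul1mx, addr0, add0r, add_block_mx, block_mx0).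
Qed.

(** * Block triangular matrices *)

Lemma lshear_inv n p (Z : 'M[F]_(p, n)) :
  block_mx 1%:M 0 Z 1%:M *m block_mx 1%:M 0 (- Z) 1%:M = 1%:M.
Proof.
by rewrite mulmx_block !(mulmx0, mul0mx, mulmx1, mul1mx, addr0, add0r) subrr -scalar_mx_block.
Qed.

Lemma lshear_inv' n p (Z : 'M[F]_(p, n)) :
  block_mx 1%:M 0 (- Z) 1%:M *m block_mx 1%:M 0 Z 1%:M = 1%:M.
Proof. by rewrite -[X in _ *m block_mx _ _ X _]opprK lshear_inv. Qed.

(** Conjugation by [[1, X], [0, 1]] adds A X - X D to the off-diagonal block. *)
Lemma sim_sylvester n p (A : 'M[F]_n) (D : 'M[F]_p) X Z :
  A *m X - X *m D = Z -> sim (block_mx A Z 0 D) (dsum_mx A D).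
Proof.
move=> e; exists (block_mx 1%:M X 0 1%:M), (block_mx 1%:M (- X) 0 1%:M); split.
- by rewrite mulmx_block !(mulmx0, mul0mx, mulmx1, mul1mx, addr0, add0r) addNr -scalar_mx_block.
- by rewrite mulmx_block !(mulmx0, mul0mx, mulmx1, mul1mx, addr0, add0r) subrr -scalar_mx_block.
rewrite /dsum_mx !mulmx_block !(mulmx0, mul0mx, mulmx1, mul1mx, addr0, add0r).
by rewrite -e subrK.
Qed.

(** The product of [[1, 1], [0, 1]] and [[1, 0], [G, 1]] is [[1 + G, 1], [G, 1]];
    a lower shear makes it block triangular with diagonal R^-1, R as soon as
    G = R + R^-1 - 2. The nonzero corner matters: -1 and its inverse, for
    example, give Jordan blocks of size 2 at -1, whereas - I_2 is not a product
    of two [U2]-matrices in characteristic different from 2. *)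
Lemma two_U2_inverse_pair n (R : 'M[F]_n) : R \in unitmx ->
  two_U2 (block_mx (invmx R) 1%:M 0 R).
Proof.
move=> uR; pose G := invmx R + R - 1%:M - 1%:M.
have : sim (block_mx (invmx R) 1%:M 0 R) (block_mx (1%:M + G) 1%:M G 1%:M).
  exists (block_mx 1%:M 0 (1%:M - R) 1%:M), (block_mx 1%:M 0 (- (1%:M - R)) 1%:M).
  rewrite lshear_inv lshear_inv'; split=> //.
  rewrite !mulmx_block !(mulmx0, mul0mx, mulmx1, mul1mx, addr0, add0r).
  rewrite mulmxBl mulmxV // mul1mx subrK.
  by congr block_mx; apply/matrixP=> i j; rewrite !mxE; ring.
move/sim_two; apply.
exists (block_mx 1%:M 1%:M 0 1%:M), (block_mx 1%:M 0 G 1%:M); split.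
- have -> : block_mx 1%:M 1%:M 0 1%:M = 1%:M + block_mx 0 1%:M 0 0 :> 'M[F]_(n + n).
    by rewrite scalar_mx_block add_block_mx !(addr0, add0r).
  by apply: sqr0_U2; rewrite mulmx_block !(mulmx0, mul0mx, addr0) block_mx0.
- have -> : block_mx 1%:M 0 G 1%:M = 1%:M + block_mx 0 0 G 0 :> 'M[F]_(n + n).
    by rewrite scalar_mx_block add_block_mx !(addr0, add0r).
  by apply: sqr0_U2; rewrite mulmx_block !(mulmx0, mul0mx, addr0) block_mx0.
- by rewrite mulmx_block !(mulmx0, mul0mx, mulmx1, mul1mx, addr0, add0r).
Qed.

Lemma opp1_inverse n : invmx (- 1%:M) = - 1%:M :> 'M[F]_n.
Proof.
have u1 : (- 1%:M : 'M[F]_n) \in unitmx by rewrite -scaleN1r unitmxZ ?unitmx1 // unitrN1.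
by apply: (can_inj (mulKmx u1)); rewrite mulmxV // mulmxN mulmx1 opprK.
Qed.

(** - 1 = [[-1, 1], [0, -1]] [[1, 1], [0, 1]], whose first factor is an inverse
    pair for R = -1. *)
Lemma three_U2_opp1_double h : three_U2 (- 1%:M : 'M[F]_(h + h)).
Proof.
have u1 : (- 1%:M : 'M[F]_h) \in unitmx by rewrite -scaleN1r unitmxZ ?unitmx1 // unitrN1.
have := two_U2_inverse_pair u1; rewrite opp1_inverse => h2.
exists (block_mx (- 1%:M) 1%:M 0 (- 1%:M)), (1%:M + block_mx 0 1%:M 0 0).
split=> //.
  by apply: sqr0_U2; rewrite mulmx_block !(mulmx0, mul0mx, addr0) block_mx0.
rewrite mulmxDr mulmx1 mulmx_block !(mulmx0, mul0mx, mulNmx, mulmx1, mul1mx, addr0, add0r).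
by rewrite add_block_mx !addr0 subrr scalar_mx_block opp_block_mx !oppr0.
Qed.

(** * Reduction to a normal form *)

Definition normal_form e r (B : 'M[F]_r) :=
  dsum_mx (- 1%:M : 'M[F]_e) (- block_mx B 1%:M 0 1%:M).

Lemma sim_normal_form e r (B B' : 'M[F]_r) : sim B B' -> sim (normal_form e B) (normal_form e B').
Proof.
case=> P [Q [PQ QP h]]; apply: sim_dsum; first exact: sim_refl.
exists (block_mx P 0 0 P), (block_mx Q 0 0 Q).
rewrite mulmxN mulNmx !mulmx_block !(mulmx0, mul0mx, mulmx1, mul1mx, addr0, add0r) PQ QP h.
by rewrite -!scalar_mx_block.
Qed.

Lemma det_opp1 n : \det (- 1%:M : 'M[F]_n) = (-1) ^+ n.
Proof. by rewrite -raddfN det_scalar. Qed.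

Lemma det_normal_form e r (B : 'M[F]_r) : \det (normal_form e B) = (-1) ^+ e * \det B.
Proof.
rewrite /normal_form /dsum_mx det_ublock det_opp1 opp_block_mx oppr0 det_ublock det_opp1.
congr (_ * _); rewrite -scaleN1r detZ mulrAC -exprD addnn -signr_odd odd_double expr0 mul1r //.
Qed.

(** 1 - G E is idempotent; factoring it through its rank gives the missing rows
    and columns of a pair of mutually inverse matrices extending E and G. *)
Lemma biorthogonal_complement m n (E : 'M[F]_(m, n)) (G : 'M[F]_(n, m)) :
  E *m G = 1%:M ->
  exists p, exists E' : 'M[F]_(p, n), exists G' : 'M[F]_(n, p),
   [/\ E' *m G' = 1%:M, E' *m G = 0, E *m G' = 0 & G *m E + G' *m E' = 1%:M].
Proof.
move=> EG; pose I : 'M[F]_n := 1%:M - G *m E.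
have GE2 : G *m E *m (G *m E) = G *m E by rewrite -mulmxA (mulmxA E) EG mul1mx.
have I2 : I *m I = I by rewrite /I mulmxBr mulmx1 mulmxBl mul1mx GE2 subrr subr0.
have EI : E *m I = 0 by rewrite mulmxBr mulmx1 mulmxA EG mul1mx subrr.
have IG : I *m G = 0 by rewrite mulmxBl mul1mx -mulmxA EG mulmx1 subrr.
exists (\rank I), (row_base I), (col_base I).
have cancelr q : injective (fun X : 'M_(q, _) => X *m row_base I).
  exact: row_free_inj (row_base_free I).
have cancell q : injective (fun X : 'M_(_, q) => col_base I *m X).
  exact: row_full_inj (col_base_full I).
split.
- apply: cancelr => /=; apply: cancell => /=.
  by rewrite mul1mx -mulmxA mulmx_base mulmxA mulmx_base I2.
- by apply: cancell; rewrite /= mulmxA mulmx_base IG mulmx0.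
- by apply: cancelr; rewrite /= -mulmxA mulmx_base EI mul0mx.
- by rewrite mulmx_base addrC subrK.
Qed.

(** With g = v - (v u) f the rows f, g are dual to the columns u, h, and
    v = (v u) f + g. In a basis completing this pair, the perturbation u v of
    - 1 therefore lives in the first r rows, with entries v u and 1. The
    condition f h = 0 is what requires twice r to be at most N. *)
Lemma low_rank_normal_form N r (u h : 'M[F]_(N, r)) (v f : 'M[F]_(r, N)) :
  f *m u = 1%:M -> v *m h = 1%:M -> f *m h = 0 ->
  exists e, sim (- 1%:M - u *m v) (normal_form e (1%:M + v *m u)).
Proof.
move=> fu vh fh; pose g := v - v *m u *m f.
have gu : g *m u = 0 by rewrite mulmxBl -(mulmxA _ f) fu mulmx1 subrr.
have gh : g *m h = 1%:M by rewrite mulmxBl vh -(mulmxA _ f) fh mulmx0 subr0.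
have EFG : col_mx f g *m row_mx u h = 1%:M.
  by rewrite mul_col_row fu fh gu gh -scalar_mx_block.
case: (biorthogonal_complement EFG) => p [E' [G' [EG EG0 GE0 idE]]].
exists p, (col_mx E' (col_mx f g)), (row_mx G' (row_mx u h)); split.
- rewrite mul_col_row EG EG0 GE0 EFG.
  by rewrite -!scalar_mx_block.
- by rewrite mul_row_col addrC.
move: EG0; rewrite mul_mx_row -row_mx0 => /eq_row_mx[Eu _].
rewrite /normal_form /dsum_mx opp_block_mx !mul_block_col !mul_col_mx.
rewrite !(oppr0, mul0mx, addr0, add0r) !mulmxBr !mulmxN !mulmx1 !mulNmx !mul1mx.
rewrite !mulmxA Eu fu gu mul1mx !mul0mx !subr0.
congr (col_mx _ (col_mx _ _)).
- by rewrite mulmxDl mul1mx /g -!opprD -addrA; congr (- (_ + _)); rewrite addrC subrK.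
- by rewrite /g opprD opprK.
Qed.

(** A + 1 = C R is a full rank factorization; the k additional coordinates,
    k >= r, serve to make the right inverse of the rows and the left inverse of
    the columns orthogonal to each other. *)
Lemma dsum_opp1_normal_form n k (A : 'M[F]_n) : (n <= k)%N ->
  exists e r (B : 'M[F]_r), sim (dsum_mx A (- 1%:M : 'M[F]_k)) (normal_form e B).
Proof.
move=> nk; pose A1 : 'M[F]_n := A + 1%:M; pose r := \rank A1.
pose C : 'M_(n, r) := col_base A1; pose R : 'M_(r, n) := row_base A1.
have CR : C *m R = A + 1%:M := mulmx_base _.
have /row_fullP[C' C'C] : row_full C := col_base_full _.
have /row_freeP[R' RR'] : row_free R := row_base_free _.
pose J : 'M[F]_(k, r) := pid_mx r; pose J' : 'M[F]_(r, k) := pid_mx r.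
have J'J : J' *m J = 1%:M.
  by rewrite pid_mx_id ?pid_mx_1 // (leq_trans (rank_leq_row _) nk).
have [||| e he] := @low_rank_normal_form (n + k) r (col_mx (- C) 0) (col_mx R' J)
   (row_mx R 0) (row_mx (- C') (C' *m R' *m J')).
- by rewrite mul_row_col mulmx0 addr0 mulNmx mulmxN opprK.
- by rewrite mul_row_col mul0mx addr0.
- by rewrite mul_row_col -mulmxA J'J mulmx1 mulNmx addNr.
exists e, r; eexists; apply: sim_trans he.
rewrite mul_col_row !(mulmx0, mul0mx) mulNmx CR scalar_mx_block !opp_block_mx add_block_mx.
rewrite !(oppr0, addr0) opprK addrC addrK; exact: sim_refl.
Qed.

(** * Factorizations of B give products of three U2-matrices *)

(** Let X be [[P + Q + 1, -1], [W, -1]]. Multiplying X on the right by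
    [[1, 0], [W, 1]] gives - [[Q P, 1], [0, 1]] for W = P + Q + 1 + Q P, and this
    W is also the value for which the shear by - (Q + 1) brings X to
    [[P, -1], [0, Q]]. The row y is carried along by the same factors. *)
Lemma three_U2_of_factorization e r (y : 'M[F]_(e, r)) (P Q : 'M[F]_r) :
  two_U2 (block_mx (- 1%:M : 'M[F]_e) (row_mx y 0) 0 (block_mx P (- 1%:M) 0 Q)) ->
  three_U2 (normal_form e (Q *m P)).
Proof.
move=> h; pose W := P + Q + 1%:M + Q *m P.
pose X := block_mx (P + Q + 1%:M) (- 1%:M) W (- 1%:M).
exists (block_mx (- 1%:M : 'M[F]_e) (row_mx y 0) 0 X).
exists (1%:M + block_mx 0 (row_mx y 0) 0 (block_mx 0 0 W 0)); split.
- apply: sim_two h.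
  exists (block_mx 1%:M 0 0 (block_mx 1%:M 0 (- (Q + 1%:M)) 1%:M)).
  exists (block_mx 1%:M 0 0 (block_mx 1%:M 0 (Q + 1%:M) 1%:M)); split.
  + rewrite mulmx_block lshear_inv' !(mulmx0, mul0mx, mulmx1, mul1mx, addr0, add0r).
    by rewrite -!scalar_mx_block.
  + rewrite mulmx_block lshear_inv !(mulmx0, mul0mx, mulmx1, mul1mx, addr0, add0r).
    by rewrite -!scalar_mx_block.
  rewrite !mulmx_block !(mulmx0, mul0mx, mulmx1, mul1mx, addr0, add0r).
  rewrite mul_row_block !(mulmx0, mul0mx, mulmx1, mul1mx, addr0, add0r).
  congr block_mx; congr block_mx.
  + by rewrite mulNmx mul1mx opprK addrA.
  + rewrite /W !(mulmxDr, mulmxDl, mulNmx, mulmxN, mulmx1, mul1mx).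
    move: (Q *m P) (Q *m Q) => QP QQ.
    by apply/matrixP=> i j; rewrite !mxE; ring.
  + rewrite mulNmx mulmxN mulmx1 opprK.
    by apply/matrixP=> i j; rewrite !mxE; ring.
- apply: sqr0_U2; rewrite !mulmx_block mul_row_block.
  by rewrite !(mulmx0, mul0mx, addr0, add0r) row_mx0 !block_mx0.
rewrite mulmxDr mulmx1 !mulmx_block mul_row_block.
rewrite !(mulmx0, mul0mx, mulNmx, mul1mx, addr0, add0r).
rewrite !add_block_mx /normal_form /dsum_mx subrr !(addr0, add0r) opp_block_mx oppr0.
congr block_mx; first by rewrite row_mx0 addr0 subrr.
congr block_mx; rewrite /W; move: (Q *m P) => QP.
by apply/matrixP=> i j; rewrite !mxE; ring.
Qed.

(** * Unipotent matrices are products of two U2-matrices *)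

Definition unipotent n (X : 'M[F]_n) := exists m, (X - 1%:M) ^+ m = 0.

Lemma unipotent1 n : unipotent (1%:M : 'M[F]_n).
Proof. by exists 1; rewrite expr1 subrr. Qed.

Lemma unipotent_conj n (G X : 'M[F]_n) : G \in unitmx ->
  unipotent X -> unipotent (invmx G *m X *m G).
Proof.
move=> uG [m hm]; exists m.
have -> : invmx G *m X *m G - 1%:M = invmx G *m (X - 1%:M) *m G.
  by rewrite mulmxBr mulmxBl mulmx1 mulVmx.
suff -> : (invmx G *m (X - 1%:M) *m G) ^+ m = invmx G *m (X - 1%:M) ^+ m *m G.
  by rewrite hm mulmx0 mul0mx.
elim: m {hm} => [|m IH]; first by rewrite !expr0 mulmx1 mulVmx.
by rewrite !exprS IH -!mulmxE !mulmxA mulmxK.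
Qed.

Lemma unipotent_tr n (X : 'M[F]_n) : unipotent X^T -> unipotent X.
Proof.
case=> m hm; exists m; apply: trmx_inj; rewrite trmx0 -hm.
have -> : X^T - 1%:M = (X - 1%:M)^T by rewrite linearB /= trmx1.
elim: m {hm} => [|m IH]; first by rewrite !expr0 trmx1.
by rewrite exprSr exprS -!mulmxE trmx_mul IH.
Qed.

Lemma unipotent_ublock n p (A : 'M[F]_n) (Z : 'M[F]_(n, p)) (D : 'M[F]_p) :
  unipotent A -> unipotent D -> unipotent (block_mx A Z 0 D).
Proof.
move=> [a ha] [d hd]; exists (a + d)%N.
rewrite scalar_mx_block opp_block_mx add_block_mx !subr0.
have hpow k : exists Y, block_mx (A - 1%:M) Z 0 (D - 1%:M) ^+ k =
    block_mx ((A - 1%:M) ^+ k) Y 0 ((D - 1%:M) ^+ k).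
  elim: k => [|k [Y IH]]; first by exists 0; rewrite !expr0 -scalar_mx_block.
  eexists; rewrite !exprS IH -!mulmxE mulmx_block !(mul0mx, mulmx0, addr0, add0r).
  by reflexivity.
rewrite exprD -mulmxE.
have [Y ->] := hpow a; have [Y' ->] := hpow d.
by rewrite ha hd mulmx_block !(mul0mx, mulmx0, addr0, add0r) block_mx0.
Qed.

Lemma unipotent_lblock n p (A : 'M[F]_n) (Z : 'M[F]_(p, n)) (D : 'M[F]_p) :
  unipotent A -> unipotent D -> unipotent (block_mx A 0 Z D).
Proof.
move=> hA hD; apply: unipotent_tr; rewrite tr_block_mx trmx0.
by apply: unipotent_ublock; apply: unipotent_tr; rewrite trmxK.
Qed.

(** The matrix c + N divides c ^ m - (- N) ^ m, which is the nonzero scalar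
    c ^ m. *)
Lemma nilpotent_add_unit n (N : 'M[F]_n) (c : F) m : c != 0 -> N ^+ m = 0 ->
  c%:M + N \in unitmx.
Proof.
move=> c0 hN.
have cm : GRing.comm (c%:M : 'M[F]_n) (- N).
  by rewrite /GRing.comm -!mulmxE scalar_mxC.
have := subrXX_comm m cm; rewrite opprK exprNn hN mulr0 subr0 => e.
have : c%:M ^+ m \in (@unitmx F n).
  by rewrite scalar_mxX scalar_mx_unit // expf_neq0.
by rewrite e -mulmxE unitmx_mul => /andP[].
Qed.

(** The nilpotent Jordan block restricted to the rows selected by [c]. *)
Definition shift_mx m (c : pred nat) : 'M[F]_m :=
  \matrix_(k, l) ((l == k.+1 :> nat) && c k)%:R.

Lemma mul_shift_mx m n c (f : nat -> 'rV[F]_n) : f m = 0 ->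
  shift_mx m c *m \matrix_(k < m) f k = \matrix_(k < m) (if c k then f k.+1 else 0).
Proof.
move=> fm; apply/row_matrixP=> k; rewrite row_mul mulmx_sum_row rowK.
under eq_bigr do rewrite !mxE rowK.
have [ltk|gek] := ltnP k.+1 m.
  rewrite (bigD1 (Ordinal ltk)) //= eqxx big1 ?addr0.
    by case: (c k); rewrite ?scale1r ?scale0r.
  by move=> l /negPf; rewrite -val_eqE /= => ->; rewrite scale0r.
have km : k.+1 = m by apply/eqP; rewrite eqn_leq gek andbT.
rewrite big1; first by rewrite km fm; case: (c k).
by move=> l _; rewrite km ltn_eqF // scale0r.
Qed.

Lemma shift_mx_sqr0 m (c : pred nat) : (forall k, c k -> ~~ c k.+1) ->
  shift_mx m c *m shift_mx m c = 0.
Proof.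
move=> hc; apply/matrixP=> k l; rewrite !mxE big1 // => t _; rewrite !mxE.
case: eqP => [->|_] /=; last by rewrite mul0r.
by case ck : (c k); rewrite ?mul0r // (negPf (hc _ ck)) andbF mulr0.
Qed.

(** Let N = X - 1 have nilpotency index m, and let x be a row with
    x N^(m-1) <> 0. A cyclic block is split off by duality, against the columns
    N^t y where y pairs nontrivially with x N^(m-1). In place of the Jordan
    basis x N^k, the basis e_k = x N^k X^-(k/2 rounded up) is used: it satisfies
    e_k X = e_k + e_(k+1) for odd k and e_k X^-1 = e_k - e_(k+1) for even k, so
    that X acts on it as a product of one square-zero perturbation of 1 that
    moves the even e_k, and another that moves the odd ones. *)
Lemma cyclic_unipotent_split n (X : 'M[F]_n) : (0 < n)%N -> unipotent X ->
  exists m p, exists (U V : 'M[F]_m) (Y : 'M[F]_p),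
   [/\ (0 < m)%N, U2_matrix U, U2_matrix V, unipotent Y & sim X (dsum_mx (U *m V) Y)].
Proof.
move=> n0 [m0 hm0]; set N := X - 1%:M in hm0.
have XE : X = 1 + N by rewrite addrC subrK.
have XE1 : X = 1%:M + N := XE.
have uX : X \in unitmx by rewrite XE (nilpotent_add_unit _ hm0) ?oner_neq0.
have exm : exists m, N ^+ m == 0 by exists m0; apply/eqP.
case: (ex_minnP exm) => m /eqP Nm minm; clear m0 hm0 exm.
case: m Nm minm => [|m'] Nm minm.
  move: Nm; rewrite expr0 => /(congr1 (fun A : 'M[F]_n => A (Ordinal n0) (Ordinal n0))).
  by move/eqP; rewrite !mxE eqxx oner_eq0.
have : N ^+ m' != 0 by apply/negP=> /minm; rewrite ltnn.
case/matrix0Pn => i [j hij].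
set m := m'.+1 in Nm minm *; set Y := invmx X.
have cNY : GRing.comm N Y.
  rewrite /GRing.comm /N mulrBl mulrBr -!mulmxE mulmxV // mulVmx //.
  by rewrite mul1mx mulmx1.
pose s k := N ^+ k * Y ^+ uphalf k.
have s_big k t : (m <= k + t)%N -> s k * N ^+ t = 0.
  move=> le; rewrite /s -mulrA (commrX t (commr_sym (commrX (uphalf k) cNY))).
  by rewrite mulrA -exprD -(subnKC le) exprD Nm !mul0r.
have s_m k : (m <= k)%N -> s k = 0.
  by move=> le; rewrite -[LHS]mulr1 -(expr0 N) s_big // addn0.
have s_odd k : odd k -> s k * X = s k + s k.+1.
  move=> ok; rewrite {1}XE mulrDr mulr1; congr (_ + _).
  rewrite /s exprSr /= !uphalf_half ok add1n -!mulrA; congr (_ * _).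
  exact: (commr_sym (commrX _ cNY)).
have s_even k : ~~ odd k -> s k * X = s k + s k.+1 + s k.+2.
  move=> ek; rewrite {1}XE mulrDr mulr1 -addrA -s_odd //; congr (_ + _).
  rewrite /s exprSr /= !uphalf_half (negPf ek) add0n exprSr -!mulrA.
  rewrite -[Y * X]/(Y *m X) mulVmx // mulr1.
  congr (_ * _); exact: (commr_sym (commrX _ cNY)).
pose e k := row i (s k).
pose E := \matrix_(k < m) e k.
pose G := \matrix_(a < n, l < m) (N ^+ (m' - l)) a j.
have EGE k l : (E *m G) k l = (s k * N ^+ (m' - l)) i j.
  by rewrite !mxE; apply: eq_bigr => t _; rewrite !mxE.
(* N^m' is fixed by X, since N^m'.+1 = 0. *)
have Ntop t : N ^+ m' * Y ^+ t = N ^+ m'.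
  elim: t => [|t IH]; first by rewrite expr0 mulr1.
  rewrite exprSr mulrA IH.
  have -> : Y = 1 - N * Y.
    have : X * Y = 1 by exact: mulmxV uX.
    by rewrite {1}XE mulrDl mul1r => <-; rewrite addrK.
  by rewrite mulrBr mulr1 mulrA -exprSr Nm mul0r subr0.
(* The pairing of the rows e_k with the columns of G is triangular, with the
   constant diagonal entry N^m' i j. *)
have uEG : E *m G \in unitmx.
  rewrite -unitmx_tr unitmxE det_trig; last first.
    apply/is_trig_mxP=> k l lt; rewrite mxE EGE s_big ?mxE //.
    have le : (k <= m')%N by rewrite -ltnS.
    by apply: (@leq_trans (k.+1 + (m' - k))); rewrite ?leq_add2r // addSn subnKC.
  rewrite unitfE; apply/prodf_neq0 => k _; rewrite mxE EGE.
  rewrite /s -mulrA (commrX _ (commr_sym (commrX (uphalf k) cNY))) mulrA -exprD.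
  by rewrite subnKC -1?ltnS // Ntop.
pose H := G *m invmx (E *m G).
have EH : E *m H = 1%:M by rewrite mulmxA mulmxV.
have [p [E' [G' [EG' E'H EG0 idE]]]] := biorthogonal_complement EH.
pose a := shift_mx m odd; pose b := shift_mx m (fun k => ~~ odd k).
exists m, p, (1%:M + b), (1%:M + a), (E' *m X *m G').
have EX : E *m X = (1%:M + b) *m (1%:M + a) *m E.
  have em k : (m <= k)%N -> e k = 0 by move=> /s_m sk; rewrite /e sk row0.
  have -> : E *m X = \matrix_(k < m) row i (s k * X).
    by apply/row_matrixP=> k; rewrite row_mul !rowK -row_mul.
  rewrite -mulmxA (mulmxDl _ _ E) mul1mx mul_shift_mx ?em //.
  pose g k := e k + (if odd k then e k.+1 else 0).
  have -> : E + \matrix_(k < m) (if odd k then e k.+1 else 0) = \matrix_(k < m) g k.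
    by apply/row_matrixP=> k; rewrite linearD /= !rowK.
  rewrite mulmxDl mul1mx mul_shift_mx; last by rewrite /g !em // if_same addr0.
  apply/row_matrixP=> k; rewrite linearD /= !rowK /g /=.
  case ok : (odd k) => /=; first by rewrite s_odd // linearD /= !addr0.
  by rewrite s_even ?ok // !linearD /= addr0 addrA.
have E'N t : E' *m col j (N ^+ t) = 0.
  have [lt|ge] := ltnP t m; last by rewrite -(subnKC ge) exprD Nm mul0r col0 mulmx0.
  have E'G : E' *m G = 0 by rewrite -[G](mulmxKV uEG) mulmxA E'H mul0mx.
  have -> : col j (N ^+ t) = col (rev_ord (Ordinal lt)) G.
    apply/colP=> x; rewrite !mxE /=; congr (fun_of_matrix (N ^+ _) _ _).
    by rewrite subSS subKn // -ltnS.
  by rewrite -col_mulmx E'G col0.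
have E'NH : E' *m N *m H = 0.
  suff E'NG : E' *m N *m G = 0 by rewrite mulmxA E'NG mul0mx.
  apply/matrixP=> x l; rewrite [RHS]mxE.
  have -> : (E' *m N *m G) x l = (E' *m col j (N ^+ (m' - l).+1)) x 0.
    rewrite exprS -mulmxE col_mulmx mulmxA !mxE; apply: eq_bigr => y _.
    by congr (_ * _); rewrite !mxE.
  by rewrite E'N mxE.
have E'NI : E' *m N *m G' *m E' = E' *m N.
  by rewrite -mulmxA -[G' *m E'](addKr (H *m E)) idE mulmxDr mulmxN mulmxA E'NH mul0mx oppr0 add0r mulmx1.
split=> //.
- by apply: sqr0_U2; apply: shift_mx_sqr0 => k /=; rewrite negbK => /negPf->.
- by apply: sqr0_U2; apply: shift_mx_sqr0 => k /= ->.
- exists m; have -> : E' *m X *m G' - 1%:M = E' *m N *m G'.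
    by rewrite {1}XE1 mulmxDr mulmx1 mulmxDl EG' addrAC subrr add0r.
  suff -> t : (E' *m N *m G') ^+ t = E' *m N ^+ t *m G' by rewrite Nm mulmx0 mul0mx.
  elim: t => [|t IH]; first by rewrite !expr0 mulmx1 EG'.
  by rewrite exprS IH -mulmxE !mulmxA E'NI exprS -mulmxE !mulmxA.
exists (col_mx E E'), (row_mx H G'); split.
- by rewrite mul_col_row EH EG0 E'H EG' -scalar_mx_block.
- by rewrite mul_row_col.
rewrite mul_col_mx mul_block_col !(mul0mx, addr0, add0r) EX; congr col_mx.
by rewrite XE1 mulmxDr mulmx1 mulmxDl EG' mulmxDl mul1mx E'NI.
Qed.

Lemma two_U2_unipotent n (X : 'M[F]_n) : unipotent X -> two_U2 X.
Proof.
elim/ltn_ind: n X => -[|n] IH X uX; first by rewrite (flatmx0 X) -(flatmx0 1%:M); apply: two_U2_1.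
have [m [p [U [V [Y [m0 hU hV hY hs]]]]]] := cyclic_unipotent_split (ltn0Sn n) uX.
apply: (sim_two hs); apply: dsum_two; first by exists U, V.
by apply: IH => //; rewrite (sim_dim hs) -[X in (X < _)%N]add0n ltn_add2r.
Qed.

(** * Triangular factorization of nonscalar matrices *)

Lemma unit_with_first_row m (x : 'rV[F]_(1 + m)) : x != 0 ->
  exists2 G : 'M[F]_(1 + m), G \in unitmx & usubmx G = x.
Proof.
move=> x0; have rx : \rank x = 1%N by rewrite rank_rV x0.
have xE := mulmx_ebase x; rewrite rx in xE.
exists (block_mx (col_ebase x) 0 0 1%:M *m row_ebase x).
  rewrite unitmx_mul row_ebase_unit andbT unitmxE det_ublock det1 mulr1 -unitmxE.
  exact: col_ebase_unit.
rewrite -mul_usub_mx col_mxKu -[RHS]xE pid_mx_row; congr (_ *m _).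
by rewrite mul_mx_row mulmx1 mulmx0.
Qed.

(** If all unit vectors and all sums of the first one with another are
    eigenvectors, then all the eigenvalues agree. *)
Lemma nonscalar_noneigenvector m (B : 'M[F]_(1 + m)) : ~~ is_scalar_mx B ->
  exists x : 'rV[F]_(1 + m), forall c, x *m B <> c *: x.
Proof.
pose d i : 'rV[F]_(1 + m) := delta_mx 0 i; pose eig (x : 'rV_(1 + m)) := (x *m B <= x)%MS.
have [|] := boolP [forall i, eig (d i) && eig (d 0 + d i)].
  move=> /forallP hB /is_scalar_mxP[].
  have /sub_rVP[c0 h0] : eig (d 0) by case/andP: (hB 0).
  exists c0; apply/row_matrixP=> i; rewrite !rowE mul_mx_scalar -/(d i).
  have [->//|ni] := eqVneq i 0.
  case/andP: (hB i) => /sub_rVP[ci hi] /sub_rVP[c].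
  rewrite mulmxDl h0 hi => /rowP hc; move: (hc 0) (hc i).
  rewrite !mxE !eqxx (negPf ni) eq_sym (negPf ni) /=.
  by rewrite !(mulr0, mulr1, addr0, add0r) => -> ->.
move=> /forallPn[i] /nandP[] /sub_rVP h _; [exists (d i) | exists (d 0 + d i)] => c e;
  by apply: h; exists c.
Qed.

(** Start a basis with a row x that is not an eigenvector: the off-diagonal part
    of its image is then nonzero, and adding multiples of x to the other basis
    vectors moves the diagonal entry to any value. *)
Lemma nonscalar_pivot m (B : 'M[F]_(1 + m)) (a : F) : ~~ is_scalar_mx B ->
  exists2 G, G \in unitmx & exists w c C,
    [/\ w != 0 & G *m B = block_mx a%:M w c C *m G].
Proof.
move=> nB.
have [x hx] := nonscalar_noneigenvector nB.
have x0 : x != 0 by apply/eqP=> e; apply: (hx 0); rewrite e mul0mx scaler0.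
have [G uG xG] := unit_with_first_row x0.
have [B1 B1E] : exists B1, G *m B = B1 *m G.
  by exists (G *m B *m invmx G); rewrite mulmxKV.
pose w := ursubmx B1.
have w0 : w != 0.
  apply/eqP=> w0; apply: (hx (ulsubmx B1 0 0)).
  have GE : G = col_mx x (dsubmx G) by rewrite -xG vsubmxK.
  have : col_mx x (dsubmx G) *m B = B1 *m col_mx x (dsubmx G) by rewrite -GE.
  rewrite -{1}[B1]submxK -/w w0 mul_block_col mul_col_mx mul0mx addr0.
  case/eq_col_mx=> -> _.
  by rewrite {1}[ulsubmx B1]mx11_scalar mul_scalar_mx.
have [v hv] : exists v : 'cV[F]_m, w *m v = ulsubmx B1 - a%:M.
  have /row_freeP[w' ww'] : row_free w by rewrite /row_free rank_rV w0.
  by exists (w' *m (ulsubmx B1 - a%:M)); rewrite mulmxA ww' mul1mx.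
exists (block_mx 1%:M 0 v 1%:M *m G).
  by rewrite unitmx_mul uG andbT unitmxE det_lblock !det1 mulr1 unitr1.
exists w.
exists (v *m ulsubmx B1 + dlsubmx B1 - (v *m w + drsubmx B1) *m v), (v *m w + drsubmx B1).
split=> //; rewrite -mulmxA B1E !mulmxA; congr (_ *m G).
rewrite -[X in _ *m X = _]submxK !mulmx_block !(mulmx0, mul0mx, mulmx1, mul1mx, addr0, add0r) -/w.

by rewrite hv subrK [a%:M + _]addrC subrK.
Qed.

Lemma orthogonal_col m (w : 'rV[F]_m) : (1 < m)%N -> exists2 v : 'cV[F]_m, v != 0 & w *m v = 0.
Proof.
move=> m1; have : cokermx w != 0.
  rewrite cokermx_eq0 /row_full neq_ltn (leq_ltn_trans (rank_leq_row w)) //.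
case/matrix0Pn => i [j hij]; exists (col j (cokermx w)).
  by apply/matrix0Pn; exists i, 0; rewrite mxE.
by rewrite -col_mulmx mulmx_coker col0.
Qed.

(** Block elimination with a prescribed pivot [a]. For an induction the Schur
    complement S has to be nonscalar again. If it is scalar, conjugating by a
    lower shear along a column v with w v = 0 keeps the pivot row and multiplies
    S by 1 + a^-1 v w, where v w is nonzero of square zero. *)
Lemma nonscalar_schur m (B : 'M[F]_(1 + m)) (a : F) :
  a != 0 -> B \in unitmx -> (0 < m)%N -> ~~ is_scalar_mx B ->
  exists2 G, G \in unitmx & exists w c S,
    [/\ G *m B = block_mx 1%:M 0 c 1%:M *m block_mx a%:M w 0 S *m G,
        \det B = a * \det S & m = 1%N \/ ~~ is_scalar_mx S].
Proof.
move=> a0 uB m0 nB; have [G uG [w [c [C [w0 e]]]]] := nonscalar_pivot a nB.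
pose d := a^-1 *: c; pose S := C - d *m w.
have BE : block_mx a%:M w c C = block_mx 1%:M 0 d 1%:M *m block_mx a%:M w 0 S.
  rewrite mulmx_block !(mulmx0, mul0mx, mulmx1, mul1mx, addr0, add0r).
  by rewrite mul_mx_scalar scalerA mulfV // scale1r addrC subrK.
have detE (G' : 'M[F]_(1 + m)) w' d' S' : G' \in unitmx ->
    G' *m B = block_mx 1%:M 0 d' 1%:M *m block_mx a%:M w' 0 S' *m G' ->
    \det B = a * \det S'.
  move=> uG' /(congr1 (fun M : 'M[F]_(1 + m) => \det M)); rewrite !det_mulmx det_lblock det_ublock.
  rewrite !det1 det_scalar1 !mul1r mulrC => /mulIf; apply.
  by rewrite -unitfE -unitmxE.
have e' : G *m B = block_mx 1%:M 0 d 1%:M *m block_mx a%:M w 0 S *m G by rewrite e BE.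
have detS := detE _ _ _ _ uG e'.
clear BE; clearbody S d.
have [nS|] := boolP (~~ is_scalar_mx S).
  by exists G => //; exists w, d, S; split=> //; right.
rewrite negbK => /is_scalar_mxP[s sE].
have [m1|m1] := leqP m 1.
  exists G => //; exists w, d, S; split=> //; left.
  by apply/eqP; rewrite eqn_leq m1.
have s0 : s != 0.
  apply: contraTneq uB => s0; rewrite unitmxE detS sE det_scalar s0 expr0n.
  by rewrite gtn_eqF ?mulr0 ?unitr0.
have [v v0 wv] := orthogonal_col w m1.
pose S' := S *m (1%:M + a^-1 *: (v *m w)).
have e2 : block_mx 1%:M 0 v 1%:M *m G *m B =
   block_mx 1%:M 0 (v + d - a^-1 *: (S *m v)) 1%:M *m block_mx a%:M w 0 S' *m
   (block_mx 1%:M 0 v 1%:M *m G).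
  rewrite -mulmxA e' !mulmxA; congr (_ *m G).
  rewrite !mulmx_block !(mulmx0, mul0mx, mulmx1, mul1mx, addr0, add0r).
  rewrite wv addr0.
  have -> : (v + d - a^-1 *: (S *m v)) *m w + S' = v *m w + (d *m w + S).
    rewrite /S' mulmxDr mulmx1 mulmxBl mulmxDl -scalemxAl -scalemxAr !mulmxA.
    move: (v *m w) (d *m w) (S *m v *m w) => A1 A2 A3.
    by apply/matrixP=> i j; rewrite !mxE; ring.
  congr block_mx; last by rewrite mulmxDl addrA.
  rewrite !mulmxDl -!mulmxA wv !mulmx0 !add0r mulNmx !mul_mx_scalar scalerA mulfV //.
  by rewrite scale1r subrK.
have uG' : block_mx 1%:M 0 v 1%:M *m G \in unitmx.
  by rewrite unitmx_mul uG andbT unitmxE det_lblock !det1 mulr1 unitr1.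
set G2 := _ *m G in e2 uG'; exists G2 => //.
exists w, (v + d - a^-1 *: (S *m v)), S'; split=> //; first exact: (detE _ _ _ _ uG' e2).
right; apply/negP => /is_scalar_mxP[t]; rewrite /S' sE mul_scalar_mx => tE.
have vw : v *m w = 0.
  have h : s *: ((1%:M + a^-1 *: (v *m w)) *m v) = t%:M *m v by rewrite scalemxAl tE.
  move: h; rewrite mulmxDl mul1mx -scalemxAl -mulmxA wv mulmx0 scaler0 addr0 mul_scalar_mx.
  case/matrix0Pn: v0 => i [j hij] /matrixP/(_ i j); rewrite !mxE => /(mulIf hij) st.
  move: tE; rewrite -st -[s%:M]mulmx1 mul_scalar_mx => /(scalerI s0).
  move/eqP; rewrite -subr_eq0 addrAC subrr add0r scaler_eq0 invr_eq0 (negPf a0) /=.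
  by move/eqP.
case/matrix0Pn: v0 => i [j hij]; case/matrix0Pn: w0 => k [l hkl].
move/matrixP/(_ i l): vw; rewrite !mxE big_ord1 => /eqP.
by rewrite mulf_eq0; move: hij hkl; rewrite (ord1 j) (ord1 k) => /negPf-> /negPf->.
Qed.

(** Iterating the elimination step with all pivots 1, the last pivot being
    det B = 1. *)
Lemma unipotent_factorization n (B : 'M[F]_n.+1) :
  \det B = 1 -> n = 0%N \/ ~~ is_scalar_mx B ->
  exists Q P, [/\ unipotent Q, unipotent P & B = Q *m P].
Proof.
elim: n B => [|n IH] B detB hB.
  exists 1%:M, 1%:M; split; try exact: unipotent1.
  by rewrite mulmx1 [B]mx11_scalar -det_mx11 detB.
have uB : B \in unitmx by rewrite unitmxE detB unitr1.
case: hB => // nB.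
have [G uG [w [c [S [e detS hS]]]]] := @nonscalar_schur n.+1 B 1 (oner_neq0 _) uB isT nB.
have [|Q1 [P1 [uQ1 uP1 SE]]] := IH S _ (match hS with or_introl e => or_introl (succn_inj e) | or_intror h => or_intror h end).
  by rewrite -detB detS mul1r.
exists (invmx G *m block_mx 1%:M 0 c Q1 *m G), (invmx G *m block_mx 1%:M w 0 P1 *m G).
split.
- by apply: unipotent_conj => //; apply: (@unipotent_lblock 1 n.+1) => //; apply: unipotent1.
- by apply: unipotent_conj => //; apply: (@unipotent_ublock 1 n.+1) => //; apply: unipotent1.
rewrite !mulmxA mulmxK // -!mulmxA; apply: (can_inj (mulKmx uG)).
rewrite mulKVmx // mulmxA e; congr (_ *m _).
by rewrite !mulmx_block !(mulmx0, mul0mx, mulmx1, mul1mx, addr0, add0r) SE.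
Qed.

(** * Nonscalar B *)

Lemma three_U2_even r (P Q : 'M[F]_r) : two_U2 (block_mx P (- 1%:M) 0 Q) ->
  three_U2 (- block_mx (Q *m P) 1%:M 0 1%:M).
Proof.
move=> h; apply: (sim_three (sim_sym (sim_dsum0 (- 1%:M) _))).
apply: (@three_U2_of_factorization 0 r 0); apply: (sim_two _ h).
by rewrite row_mx0; apply: sim_dsum0.
Qed.

Lemma three_U2_even_nonscalar n (B : 'M[F]_n.+1) : \det B = 1 -> ~~ is_scalar_mx B ->
  three_U2 (- block_mx B 1%:M 0 1%:M).
Proof.
move=> dB nB; have [Q [P [uQ uP ->]]] := unipotent_factorization dB (or_intror nB).
by apply: three_U2_even; apply: two_U2_unipotent; apply: unipotent_ublock.
Qed.

(** With N ^ 2 = 0 the equation N X - X (1 + T) = Z is solved by two terms of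
    the Neumann series. *)
Lemma sylvester_opp1 n p (N : 'M[F]_n) (T : 'M[F]_p) (Z : 'M[F]_(n, p)) :
  N *m N = 0 -> 1%:M + T \in unitmx -> exists X, (- 1%:M + N) *m X - X *m T = Z.
Proof.
move=> N2 uT; pose X0 := - (Z *m invmx (1%:M + T)).
have X0E : X0 *m (1%:M + T) = - Z by rewrite mulNmx mulmxKV.
exists (X0 + N *m X0 *m invmx (1%:M + T)); set X := X0 + _.
have XE : X *m (1%:M + T) = - Z + N *m X0 by rewrite mulmxDl X0E mulmxKV.
have NX : N *m X = N *m X0 by rewrite mulmxDr !mulmxA N2 !mul0mx addr0.
rewrite mulmxDl mulNmx mul1mx NX.
have -> : X *m T = - Z + N *m X0 - X by rewrite -XE mulmxDr mulmx1 addrC addKr.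
by clearbody X X0; move: (N *m X0) => Y; apply/matrixP=> i j; rewrite !mxE; ring.
Qed.

(** The additional coordinate -1 and the first coordinate of P form the block
    [[-1, 1], [0, -1]]. The remaining coordinates carry T, and as -1 is not an
    eigenvalue of T the matrix splits accordingly. *)
Lemma three_U2_odd m (w : 'rV[F]_m) (P1 : 'M[F]_m) (Q : 'M[F]_(1 + m)) :
  let T := block_mx P1 (- row_mx 0 1%:M) 0 Q in
  1%:M + T \in unitmx -> two_U2 T ->
  three_U2 (normal_form 1 (Q *m block_mx (- 1%:M) w 0 P1)).
Proof.
move=> T uT hT; apply: (@three_U2_of_factorization 1 (1 + m) (row_mx 1%:M 0)).
have -> : (- 1%:M : 'M[F]_(1 + m)) = col_mx (- row_mx 1%:M 0) (- row_mx 0 1%:M).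
  by rewrite -opp_col_mx scalar_mx_block.
pose W := row_mx w (- row_mx 1%:M 0 : 'M[F]_(1, 1 + m)).
(* The sizes 1 + m + (1 + m) and 1 + (m + (1 + m)) are convertible, so the
   casts of the associativity lemmas are along reflexive equations. *)
have inner : block_mx (block_mx (- 1%:M) w 0 P1) (col_mx (- row_mx 1%:M 0) (- row_mx 0 1%:M)) 0 Q =
   block_mx (- 1%:M : 'M[F]_1) W 0 T :> 'M_(1 + (m + (1 + m))).
  rewrite -[in RHS]col_mx0 /W /T (@block_mxA _ 1 m (1 + m) 1 m (1 + m)) castmx_id.
  by rewrite row_mx0.
have rowE : row_mx (row_mx 1%:M 0) (0 : 'M[F]_(1, 1 + m)) =
    row_mx (1%:M : 'M[F]_1) (0 : 'M[F]_(1, m + (1 + m))).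
  by rewrite -[in RHS]row_mx0 row_mxA castmx_id.
rewrite inner rowE.
have := @sim_blockA 1 1 _ (- 1%:M) 1%:M 0 0 0 (- 1%:M) W 0 T.
rewrite col_mx0 row_mx0 => /sim_two; apply.
have [X hX] := @sylvester_opp1 _ _ (block_mx 0 1%:M 0 0 : 'M[F]_(1 + 1)) T (col_mx 0 W)
  ltac:(by rewrite mulmx_block !(mulmx0, mul0mx, addr0) block_mx0) uT.
have JE : block_mx (- 1%:M) 1%:M 0 (- 1%:M) = - 1%:M + block_mx 0 1%:M 0 0 :> 'M[F]_(1 + 1).
  by rewrite scalar_mx_block opp_block_mx add_block_mx oppr0 !(addr0, add0r).
apply: (sim_two (sim_sylvester _)); first by rewrite JE; exact: hX.
apply: dsum_two => //; rewrite -{1}opp1_inverse; apply: two_U2_inverse_pair.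
by rewrite -scaleN1r unitmxZ ?unitmx1 // unitrN1.
Qed.

(** One elimination step with pivot -1 leaves a Schur complement of determinant
    1, which is a product of two unipotent matrices. *)
Lemma three_U2_odd_nonscalar m (B : 'M[F]_(1 + m)) : (2 : F) != 0 ->
  \det B = -1 -> ~~ is_scalar_mx B -> three_U2 (normal_form 1 B).
Proof.
move=> two0 dB nB; case: m B dB nB => [|m] B dB nB.
  by case/negP: nB; rewrite [B]mx11_scalar scalar_mx_is_scalar.
have uB : B \in unitmx by rewrite unitmxE dB unitrN1.
have N1 : (-1 : F) != 0 by rewrite oppr_eq0 oner_neq0.
have [G uG [w [c [S [e detS hS]]]]] := nonscalar_schur N1 uB isT nB.
have dS : \det S = 1 by apply: oppr_inj; rewrite -dB detS mulN1r.
have [Q1 [P1 [uQ1 uP1 SE]]] := unipotent_factorization dS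
  (match hS with or_introl e => or_introl (succn_inj e) | or_intror h => or_intror h end).
have : sim B (block_mx 1%:M 0 c Q1 *m block_mx (- 1%:M) w 0 P1).
  exists G, (invmx G); rewrite mulmxV // mulVmx //; split=> //; rewrite e; congr (_ *m _).
  rewrite !mulmx_block !(mulmx0, mul0mx, mulmx1, mul1mx, addr0, add0r) SE.
  by rewrite raddfN.
move/(sim_normal_form 1)/sim_three; apply; apply: three_U2_odd.
  set T := block_mx _ _ _ _; have [k hk] : unipotent T.
    by apply: unipotent_ublock => //; apply: unipotent_lblock => //; apply: unipotent1.
  have -> : 1%:M + T = 2%:M + (T - 1%:M).
    by rewrite -[2]/(1 + 1) raddfD /= -addrA; congr (_ + _); rewrite addrC subrK.
  exact: nilpotent_add_unit two0 hk.
apply: two_U2_unipotent.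
by apply: unipotent_ublock => //; apply: unipotent_lblock => //; apply: unipotent1.
Qed.

(** * Scalar B with e = 0 *)

(** Since (C - D) (C^(m-1) + ... + D^(m-1)) = c - d, the sum divided by c - d
    inverts C - D, and hence solves the Sylvester equation. *)
Lemma sim_power_sylvester n (C D : 'M[F]_n) m (c d z : F) :
  C *m D = D *m C -> C ^+ m = c%:M -> D ^+ m = d%:M -> c != d ->
  sim (block_mx C z%:M 0 D) (dsum_mx C D).
Proof.
move=> cCD hC hD cd; have cD : GRing.comm C D by [].
have := subrXX_comm m cD; set S := \sum_(i < m) _ => hS.
have cDS : D * S = S * D.
  apply: commr_sum => i _; apply: commrM; apply: commrX.
    exact: esym cD.
  exact: commr_refl.
apply: (@sim_sylvester _ _ _ _ ((z / (c - d)) *: S)).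
rewrite -scalemxAr -scalemxAl -scalerBr.
have -> : C *m S - S *m D = (c - d)%:M.
  rewrite [S *m D](esym cDS) -mulmxBl [LHS](esym hS) hC hD.
  by rewrite raddfB.
by rewrite -scalemx1 scalerA divfK ?subr_eq0 // scalemx1.
Qed.

(** C is the cyclic shift with one weight b, and T is the diagonal matrix of the
    powers of b. At the corner of C the relation uses b ^ r.+1 = 1. *)
Lemma cyclic_shift_root r (b : F) : b ^+ r.+1 = 1 ->
  exists C T : 'M[F]_r.+1,
    [/\ C \in unitmx, T \in unitmx, C ^+ r.+1 = b%:M & C *m T = b *: (T *m C)].
Proof.
move=> br; have b0 : b != 0.
  by apply: contra_eq_neq br => ->; rewrite expr0n /= eq_sym oner_neq0.
pose d i : 'rV[F]_r.+1 := delta_mx 0 i.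
pose C := \matrix_(i < r.+1) (if (i < r)%N then d (inord i.+1) else b *: d 0).
pose T : 'M[F]_r.+1 := diag_mx (\row_i b ^+ i).
have dC i : d i *m C = if (i < r)%N then d (inord i.+1) else b *: d 0.
  by rewrite -rowE rowK.
have dT i : d i *m T = b ^+ i *: d i.
  by rewrite -rowE row_diag_mx mxE.
have d0C k : (k <= r)%N -> d 0 *m C ^+ k = d (inord k).
  elim: k => [|k IH] kr.
    by rewrite expr0 mulmx1; congr d; apply: val_inj; rewrite /= inordK.
  rewrite exprSr -mulmxE mulmxA IH ?(ltnW kr) // dC inordK ?ltnS ?(ltnW kr) //.
  by rewrite kr.
have d0Cr : d 0 *m C ^+ r.+1 = b *: d 0.
  by rewrite exprSr -mulmxE mulmxA d0C // dC inordK // ltnn.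
have Cr : C ^+ r.+1 = b%:M.
  apply/row_matrixP=> i; rewrite !rowE -/(d i) mul_mx_scalar.
  have -> : d i = d 0 *m C ^+ i by rewrite d0C ?inord_val // -ltnS.
  rewrite -mulmxA mulmxE -exprD addnC exprD -mulmxE mulmxA d0Cr.
  by rewrite scalemxAl.
exists C, T; split=> //.
- have : C *m C ^+ r \in unitmx by rewrite [C *m _](esym (exprS _ _)) Cr scalar_mx_unit.
  by rewrite unitmx_mul => /andP[].
- rewrite unitmxE det_diag unitfE; apply/prodf_neq0 => i _.
  by rewrite mxE expf_neq0.
apply/row_matrixP=> i; rewrite !rowE -/(d i) -scalemxAr !mulmxA dT dC -scalemxAl dC scalerA -exprS.
case: ltnP => [lt|ge]; first by rewrite dT inordK ?ltnS.
have -> : i = r :> nat by apply/eqP; rewrite eqn_leq ge -ltnS ltn_ord.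
by rewrite br scale1r -scalemxAl dT expr0 scale1r.
Qed.

Lemma opp1_exp_even r : (2 : F) != 0 -> (-1 : F) ^+ r = 1 -> ~~ odd r.
Proof.
move=> two0; rewrite -signr_odd; case: (odd r) => //; rewrite expr1 => e.
by case/eqP: two0; rewrite -[2]/(1 + 1) -{1}e addNr.
Qed.

Lemma three_U2_opp1_even r : ~~ odd r -> three_U2 (- 1%:M : 'M[F]_r).
Proof.
by move=> /even_halfK <-; rewrite -addnn; apply: three_U2_opp1_double.
Qed.

(** For b = 1 unipotent factors work. For b = -1 the matrix is similar to the
    direct sum of I_r and - I_r, where r is even. Otherwise take P the shift C, and
    Q = b C^-1, which is similar to C^-1 through T; as b <> b^-1, both
    [[C, -1], [0, Q]] and [[C, 1], [0, C^-1]] split, and so they are similar. *)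
Lemma three_U2_even_scalar r (b : F) : (2 : F) != 0 -> b ^+ r = 1 ->
  three_U2 (- block_mx (b%:M : 'M[F]_r) 1%:M 0 1%:M).
Proof.
move=> two0 br.
have one : three_U2 (- block_mx (1%:M : 'M[F]_r) 1%:M 0 1%:M).
  rewrite -{1}[1%:M]mulmx1; apply: three_U2_even; apply: two_U2_unipotent.
  by apply: unipotent_ublock; apply: unipotent1.
have [->//|b1] := eqVneq b 1.
have [bN|bN] := eqVneq b (-1).
  rewrite bN in br *.
  apply: (@sim_three _ _ _ (dsum_mx 1%:M (- 1%:M : 'M[F]_r))).
    rewrite opp_block_mx oppr0 raddfN opprK.
    apply: (@sim_sylvester _ _ _ _ (- 2^-1)%:M).
    rewrite mul1mx mulmxN mulmx1 opprK -raddfD -raddfN; congr _%:M.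
    by field.
  apply: dsum_three; first exact/two_U2_three/two_U2_1.
  exact: three_U2_opp1_even (opp1_exp_even two0 br).
case: r br one => [|r] br one.
  by have -> : b%:M = 1%:M :> 'M[F]_0 by apply/matrixP => -[].
have b0 : b != 0.
  by apply: contra_eq_neq br => ->; rewrite expr0n /= eq_sym oner_neq0.
have bV : b != b^-1.
  apply/eqP=> e; have : (b - 1) * (b + 1) = 0.
    by rewrite mulrDr mulr1 mulrBl mul1r {2}e mulfV //; ring.
  by move/eqP; rewrite mulf_eq0 subr_eq0 addr_eq0 (negPf b1) (negPf bN).
have [C [T [uC uT Cr CT]]] := cyclic_shift_root br.
pose Q := b *: invmx C.
have QC : Q *m C = b%:M by rewrite -scalemxAl mulVmx // scalemx1.
have CQ : C *m Q = b%:M by rewrite -scalemxAr mulmxV // scalemx1.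
have CVr : invmx C ^+ r.+1 = b^-1%:M.
  by rewrite -[invmx C]/(C^-1) exprVn Cr -invmx_scalar.
have Qr : Q ^+ r.+1 = b^-1%:M by rewrite exprZn br scale1r.
rewrite -QC; apply: three_U2_even.
rewrite -raddfN; apply: (sim_two (sim_power_sylvester _ _ Cr Qr bV)); first by rewrite QC CQ.
have simQ : sim Q (invmx C).
  exists (invmx T), T; rewrite mulmxV // mulVmx //; split=> //.
  apply: (can_inj (mulKmx uT)); rewrite mulKVmx //.
  apply: (can_inj (mulmxK uT)); rewrite -!mulmxA mulVmx // mulmx1.
  apply: (can_inj (mulKmx uC)); rewrite mulmxA CQ !mulmxA CT.
  by rewrite -!scalemxAl mulmxK // mul_scalar_mx.
apply: (sim_two (sim_dsum (sim_refl C) simQ)).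
have cV : C *m invmx C = invmx C *m C by rewrite mulmxV // mulVmx.
apply: (sim_two (sim_sym (sim_power_sylvester 1 cV Cr CVr bV))).
by rewrite -{1}[C]invmxK; apply: two_U2_inverse_pair; rewrite unitmx_inv.
Qed.

(** * Scalar B with e = 1 *)

(** Indexing the entries by all of nat lets the size change, as in m + 1 and
    1 + m, without touching the function. *)
Definition diagf n (f : nat -> F) : 'M[F]_n := diag_mx (\row_(i < n) f i).

Lemma diagf_unit n f : (forall i, (i < n)%N -> f i != 0) -> diagf n f \in unitmx.
Proof.
move=> h; rewrite unitmxE det_diag unitfE; apply/prodf_neq0 => i _.
by rewrite mxE h.
Qed.

Lemma diagf_mul n f g : diagf n f *m diagf n g = diagf n (fun i => f i * g i).
Proof.
by rewrite mulmx_diag; congr diag_mx; apply/rowP=> i; rewrite !mxE.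
Qed.

Lemma diagf_const n f c : (forall i, (i < n)%N -> f i = c) -> diagf n f = c%:M.
Proof.
by move=> h; rewrite -diag_const_mx; congr diag_mx; apply/rowP=> i; rewrite !mxE h.
Qed.

Lemma diagf_inv n f : (forall i, (i < n)%N -> f i != 0) ->
  invmx (diagf n f) = diagf n (fun i => (f i)^-1).
Proof.
move=> h; apply: (can_inj (mulKmx (diagf_unit h))).
rewrite mulmxV ?diagf_unit // diagf_mul (@diagf_const _ _ 1) // => i hi.
by rewrite mulfV ?h.
Qed.

Lemma diagf_add n p f :
  diagf (n + p) f = dsum_mx (diagf n f) (diagf p (fun i => f (n + i)%N)).
Proof.
rewrite /dsum_mx -diag_mx_row; congr diag_mx; apply/rowP=> i; rewrite !mxE.
by case: splitP => j ->; rewrite mxE.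
Qed.

Lemma sim_diagf_sylvester n p f g (Z : 'M[F]_(n, p)) :
  (forall i j, (i < n)%N -> (j < p)%N -> f i != g j) ->
  sim (block_mx (diagf n f) Z 0 (diagf p g)) (dsum_mx (diagf n f) (diagf p g)).
Proof.
move=> h; apply: (@sim_sylvester _ _ _ _ (\matrix_(i, j) (Z i j / (f i - g j)))).
apply/matrixP=> i j; rewrite mul_diag_mx mul_mx_diag !mxE.
by rewrite [X in _ - X]mulrC -mulrBl mulrC divfK // subr_eq0 h.
Qed.

Lemma two_U2_diagf_pair n f : (forall i, (i < n)%N -> f i != 0) ->
  (forall i j, (i < n)%N -> (j < n)%N -> f i != (f j)^-1) ->
  two_U2 (dsum_mx (diagf n f) (diagf n (fun i => (f i)^-1))).
Proof.
move=> f0 ff; apply: (sim_two (sim_sym (sim_diagf_sylvester 1%:M ff))).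
rewrite -(diagf_inv f0) -{1}[diagf n f]invmxK; apply: two_U2_inverse_pair.
by rewrite unitmx_inv diagf_unit.
Qed.

(** P has the entries b^(m+1) = -1, b^m, ..., b and Q has the entries
    b^-m, ..., b^-1, 1. Without the entry -1 of P, these are the pairs
    x, x^-1 for x = b^m, ..., b, and an isolated 1. By minimality b has order
    2 (m + 1), so that no power of b occurs both among the remaining entries of
    P and among those of Q. *)
Lemma three_U2_odd_scalar_min m (b : F) : (2 : F) != 0 -> b ^+ m.+1 = -1 ->
  (forall k, (k <= m)%N -> b ^+ k != -1) ->
  three_U2 (normal_form 1 (b%:M : 'M[F]_m.+1)).
Proof.
move=> two0 bm bk.
have N1 : (-1 : F) != 0 by rewrite oppr_eq0 oner_neq0.
have b0 : b != 0.
  by apply: contra_eq_neq bm => ->; rewrite expr0n /= eq_sym.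
have bX k : b ^+ k != 0 by rewrite expf_neq0.
have b1 k : (0 < k)%N -> (k <= m + m)%N -> b ^+ k != 1.
  move=> k0 km; apply/eqP=> e; have [le|gt] := leqP k m.
    have /negP[] := bk (m.+1 - k)%N ltac:(by rewrite leq_subLR -addn1 addnC leq_add2r).
    have : b ^+ (m.+1 - k) * b ^+ k = -1 by rewrite -exprD subnK ?bm // leqW.
    by rewrite e mulr1 => ->.
  have le : (k - m.+1 <= m)%N by rewrite leq_subLR addSn (leq_trans km).
  have /negP[] := bk _ le.
  have : b ^+ (k - m.+1) * b ^+ m.+1 = 1 by rewrite -exprD subnK.
  by rewrite bm mulrN1 => /(congr1 -%R); rewrite opprK => ->.
pose f i := b ^+ (m - i); pose p i := b ^+ (m.+1 - i).
have QE : diagf (1 + m) (fun i => (f i)^-1) *m block_mx (- 1%:M : 'M[F]_1) 0 0 (diagf m f) = b%:M.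
  have -> : block_mx (- 1%:M : 'M[F]_1) 0 0 (diagf m f) = diagf (1 + m) p.
    rewrite diagf_add /dsum_mx; congr block_mx.
    by rewrite (@diagf_const _ _ (-1)) ?raddfN // => -[].
  rewrite diagf_mul; apply: diagf_const => i hi.
  by rewrite /f /p subSn // exprS mulrC mulfK.
rewrite -QE; apply: three_U2_odd.
  set T := block_mx _ _ _ _.
  have -> : 1%:M + T = block_mx (diagf m (fun i => 1 + f i)) (- row_mx 0 1%:M) 0
                         (diagf (1 + m) (fun i => 1 + (f i)^-1)).
    rewrite /T [1%:M]scalar_mx_block add_block_mx !add0r.
    by congr block_mx; apply/matrixP=> i j; rewrite !mxE; case: (i == j); rewrite ?mulr1n ?mulr0n ?addr0.
  rewrite unitmxE det_ublock unitrM -!unitmxE; apply/andP; split; apply: diagf_unit => i hi.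
    by rewrite addrC addr_eq0 bk // leq_subr.
  rewrite addrC addr_eq0 -invrN1 (inj_eq invr_inj); exact/bk/leq_subr.
have sep i j : (i < m)%N -> (j < m.+1)%N -> f i != (f j)^-1.
  move=> hi hj; apply/eqP => e; have /eqP[] : b ^+ (m - i + (m - j)) != 1.
    by rewrite b1 ?addn_gt0 ?subn_gt0 ?hi // leq_add ?leq_subr.
  by rewrite exprD [b ^+ (m - i)]e /f mulVf ?bX.
apply: (sim_two (sim_diagf_sylvester _ sep)).
have -> : diagf m.+1 (fun i => (f i)^-1) = diagf (1 + m) (fun i => (f i)^-1) by [].
(* The isolated entry 1 of Q is its last one. *)
have simQ : sim (diagf (1 + m) (fun i => (f i)^-1)) (dsum_mx (diagf m (fun i => (f i)^-1)) (1%:M : 'M[F]_1)).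
  rewrite addnC diagf_add [X in dsum_mx _ X](@diagf_const _ _ 1); first exact: sim_refl.
  by case=> // _; rewrite addn0 /f subnn invr1.
apply: (sim_two (sim_dsum (sim_refl _) simQ)); apply: (sim_two (sim_dsumA _ _ _)).
apply: dsum_two; last exact: two_U2_1.
by apply: two_U2_diagf_pair => [i _|i j hi hj]; [apply: bX | apply: sep => //; apply: ltnW].
Qed.

Lemma three_U2_odd_scalar r (b : F) : (2 : F) != 0 -> b ^+ r = -1 ->
  three_U2 (normal_form 1 (b%:M : 'M[F]_r)).
Proof.
move=> two0 br; have exk : exists k, b ^+ k == -1 by exists r; apply/eqP.
case: (ex_minnP exk) => -[|m] /eqP bm minm.
  move: bm => /eqP; rewrite expr0 eq_sym -subr_eq0 -opprD oppr_eq0.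
  by rewrite -[1 + 1]/(2 : F) (negPf two0).
have mr : (m.+1 <= r)%N by apply: minm; rewrite br.
have bs : b ^+ (r - m.+1) = 1.
  by apply: oppr_inj; rewrite -mulrN1 -{1}bm -exprD subnK.
rewrite -(subnKC mr); move: (r - m.+1)%N bs => s bs; clear br mr.
apply: (@sim_three _ _ _ (dsum_mx (normal_form 1 (b%:M : 'M_m.+1)) (- block_mx (b%:M : 'M_s) 1%:M 0 1%:M))).
  apply: sim_trans (sim_dsumA _ _ _); apply: sim_dsum; first exact: sim_refl.
  rewrite !opp_block_mx !oppr0.
  have opp_scalar c : - c%:M = dsum_mx (- c%:M) (- c%:M) :> 'M[F]_(m.+1 + s).
    by rewrite scalar_mx_block opp_block_mx !oppr0.
  have zero : 0 = dsum_mx 0 0 :> 'M[F]_(m.+1 + s) by rewrite /dsum_mx block_mx0.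
  rewrite !opp_scalar zero; exact: sim_shuffle.
apply: dsum_three; last exact: three_U2_even_scalar.
apply: three_U2_odd_scalar_min => // k km; apply/negP=> /minm.
by rewrite ltnNge km.
Qed.

(** * Conclusion *)

Lemma three_U2_normal_form_bool (o : bool) r (B : 'M[F]_r) : (2 : F) != 0 ->
  (-1) ^+ o * \det B = 1 -> three_U2 (normal_form o B).
Proof.
move=> two0; have [/is_scalar_mxP[b ->]|nB] := boolP (is_scalar_mx B).
  rewrite det_scalar; case: o => dB.
    by apply: three_U2_odd_scalar => //; apply: oppr_inj; rewrite opprK -dB mulN1r.
  apply: (sim_three (sim_dsum0 _ _)); apply: three_U2_even_scalar => //.
  by rewrite -dB mul1r.
case: r B nB => [|r] B nB.
  by case/is_scalar_mxP: nB; exists 0; apply/matrixP => -[].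
case: o => dB.
  by apply: (@three_U2_odd_nonscalar r) => //; apply: oppr_inj; rewrite opprK -dB mulN1r.
apply: (sim_three (sim_dsum0 _ _)); apply: three_U2_even_nonscalar => //.
by rewrite -dB mul1r.
Qed.

Lemma three_U2_normal_form e r (B : 'M[F]_r) : (2 : F) != 0 ->
  (-1) ^+ e * \det B = 1 -> three_U2 (normal_form e B).
Proof.
move=> two0 dB.
have {dB} : three_U2 (normal_form (odd e) B).
  by apply: three_U2_normal_form_bool; rewrite ?signr_odd.
move: (odd_double_half e); rewrite addnC -addnn.
move: e./2 (nat_of_bool (odd e)) => h o <- hB.
rewrite /normal_form [1%:M in X in dsum_mx X](scalar_mx_block (h + h) o) opp_block_mx !oppr0.
apply: (sim_three (sim_sym (sim_dsumA _ _ _))).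
by apply: dsum_three => //; apply: three_U2_opp1_double.
Qed.

End ThreeU2.

Theorem theorem1p12 (F : fieldType) (hF : 2%N \notin [pchar F])
  (n : nat) (A : 'M[F]_n) (hA : A \in unitmx)
  (k : nat) (hk : (n <= k)%N) (hdet : (-1) ^+ k * \det A = 1) :
  exists U1 U2 U3 : 'M[F]_(n + k),
    [/\ U2_matrix U1, U2_matrix U2, U2_matrix U3
      & dsum_mx A (- 1%:M : 'M[F]_k) = U1 *m U2 *m U3].
Proof.
have two0 : (2 : F) != 0 by move: hF; rewrite inE.
have [e [r [B sB]]] := dsum_opp1_normal_form A hk.
have dB : (-1) ^+ e * \det B = 1.
  by rewrite -det_normal_form -(sim_det sB) det_ublock det_opp1 mulrC.
have [X [U3 [[U1 [U2 [hU1 hU2 ->]]] hU3 ->]]] := sim_three sB (three_U2_normal_form two0 dB).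
by exists U1, U2, U3.
Qed.
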